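(* Let $\alpha,\beta$ be two different irrational real numbers such that $\alpha+\beta\notin\mathbb{Z}$ and $\alpha-\beta\notin\mathbb{Z}$. Then the difference function $\psi_\alpha(t)-\psi_\beta(t)$ changes its sign infinitely many times as $t\to+\infty$; that is, for every $T>0$ there exist $t_1,t_2>T$ with $\psi_\alpha(t_1)>\psi_\beta(t_1)$ and $\psi_\alpha(t_2)<\psi_\beta(t_2)$.
   Context: For a real number $\xi$ and real $t\geq 1$, the irrationality measure function is $\psi_\xi(t)=\min_{1\leq x\leq t,\ x\in\mathbb{Z}}\|x\xi\|$, where $\|\cdot\|$ denotes the distance to the nearest integer. *)

(* Defs.v *)
From mathcomp Require Import all_boot all_order all_algebra.
From mathcomp Require Import classical_sets reals.

Set Implicit Arguments.
Unset Strict Implicit.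
Unset Printing Implicit Defensive.

Import Order.TTheory GRing.Theory Num.Theory.

Local Open Scope classical_set_scope.
Local Open Scope ring_scope.

Definition dist_int (R : realType) (x : R) : R :=
  inf [set `|x - k%:~R| | k in [set: int]].

(* The minimum is written as an infimum: for 1 <= t the two agree
   (irr_measure_attained), and for t < 1 the set is empty and the value is 0. *)
Definition irr_measure (R : realType) (xi t : R) : R :=
  inf [set dist_int (x%:~R * xi) | x in [set x : int | (1 : R) <= x%:~R <= t]].

Lemma dist_int_le (R : realType) (x : R) (k : int) :
  dist_int x <= `|x - k%:~R|.
Proof.
apply: ge_inf; last by exists k.
by exists 0 => _ [j _ <-]; exact: normr_ge0.
Qed.

Lemma dist_int_attained (R : realType) (x : R) :
  exists k : int, dist_int x = `|x - k%:~R|.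
Proof.
pose f := Num.floor x; pose a := x - f%:~R; pose b := (f + 1)%:~R - x.
have a0 : 0 <= a by rewrite subr_ge0 floor_le.
have b0 : 0 <= b by rewrite subr_ge0 ltW // floorD1_gt.
have lbk (k : int) : Num.min a b <= `|x - k%:~R|.
  rewrite ge_min; case: (lerP k f) => [kf|fk].
    apply/orP; left; apply: le_trans (ler_norm _).
    by rewrite lerD2l lerN2 ler_int.
  apply/orP; right; rewrite distrC; apply: le_trans (ler_norm _).
  by rewrite lerD2r ler_int lezD1.
have minle : Num.min a b <= dist_int x.
  apply: lb_le_inf; first by exists `|x - 0%:~R|, 0.
  by move=> _ [k _ <-].
case: (leP a b) minle => ab minle.
  exists f; apply/le_anti; rewrite dist_int_le /=.
  by rewrite ger0_norm.
exists (f + 1); apply/le_anti; rewrite dist_int_le /=.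
by rewrite distrC ger0_norm.
Qed.

Lemma dist_int_ge0 (R : realType) (x : R) : 0 <= dist_int x.
Proof. by have [k ->] := dist_int_attained x. Qed.

Lemma irr_measure_le (R : realType) (xi t : R) (x : int) :
  (1 : R) <= x%:~R <= t -> irr_measure xi t <= dist_int (x%:~R * xi).
Proof.
move=> xt; apply: ge_inf; last by exists x.
by exists 0 => _ [j _ <-]; exact: dist_int_ge0.
Qed.

Lemma irr_measure_attained (R : realType) (xi t : R) : 1 <= t ->
  exists2 x : int, (1 : R) <= x%:~R <= t & irr_measure xi t = dist_int (x%:~R * xi).
Proof.
move=> t1; have t0 : 0 <= t by apply: le_trans t1.
pose n := Num.truncn t.
have n0 : (0 < n)%N by rewrite truncn_gt0.
pose F (i : 'I_n) : R := dist_int (i.+1%:~R * xi).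
case: (arg_minP F (isT : xpredT (Ordinal n0))) => i _ imin.
have it : (1 : R) <= i.+1%:~R <= t.
  rewrite ler1n /=; apply: le_trans (_ : n%:R <= t); last by rewrite truncn_le.
  by rewrite ler_nat.
exists i.+1%:Z => //; apply/le_anti; rewrite irr_measure_le //=.
apply: lb_le_inf; first by exists (F i), i.+1%:Z.
move=> _ [[[|m]|m] /andP[m1 mt] <-]; [by move: m1; rewrite ler10 | | ].
  have mn : (m < n)%N by rewrite truncn_ge_nat.
  exact: (imin (Ordinal mn)).
by move: m1; rewrite NegzE mulrNz => /le_trans /(_ (_ : _ <= 0));
  rewrite oppr_le0 ler0n ler10 => /(_ isT).
Qed.

(* Main.v *)
(* Suppose psi_alpha <= psi_beta from some point on. Take consecutive best
   denominators b < s of beta, with eta = ||b beta|| and eta' = ||s beta||,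
   between which psi_alpha drops; the corresponding lattice vectors have
   determinant s eta + b eta' = 1. Let psi_alpha(b) and psi_alpha(s) be attained
   at a <= b and a' <= s. The two corresponding lattice vectors for alpha are
   independent, so 1 <= a' ||a alpha|| + a ||a' alpha|| <= s eta + b eta' = 1.
   Equality forces a = b, a' = s and equal distances, with remainders of opposite
   signs on both sides. Hence for one choice of sign alpha -+ beta is mapped to an
   integer by both b and s, and so it is an integer by unimodularity. *)
Require Import Defs.
From mathcomp Require Import all_boot all_order all_algebra.
From mathcomp Require Import classical_sets reals.
From mathcomp Require Import boolp zify ring lra.
Import Order.TTheory GRing.Theory Num.Theory.
Local Open Scope ring_scope.

(** * Dirichlet approximation *)

Lemma dirichlet {R : realType} (xi : R) (N : nat) : (1 < N)%N ->
  exists2 n : nat, (0 < n < N)%N & N%:R * dist_int (n%:R * xi) <= 1.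
Proof.
move=> N1.
have N0 : 0 < N%:R :> R by rewrite ltr0n; lia.
pose fl (i : nat) := Num.floor (i%:R * xi).
pose fr (i : nat) : R := i%:R * xi - (fl i)%:~R.
have fr_ge0 i : 0 <= fr i by rewrite subr_ge0 floor_le.
have fr_lt1 i : fr i < 1.
  by rewrite /fr ltrBlDl -(@intrD R (fl i) 1) floorD1_gt.
(* Either two of the N points share a box of length 1/N, or the last box, whose
   points are within 1/N of an integer, is occupied. *)
have box_lt (i : 'I_N) : (Num.truncn (N%:R * fr i) < N)%N.
  by rewrite truncn_lt_nat ?mulr_ge0 ?ler0n// gtr_pMr.
pose box (i : 'I_N) := Ordinal (box_lt i).
have [box_inj|] := boolP (injectiveb box).
  have last_lt : (N.-1 < N)%N by lia.
  have /injF_onto/(_ (Ordinal last_lt))/codomP[i iE] := injectiveP _ box_inj.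
  have boxi : N.-1 = Num.truncn (N%:R * fr i) by have := congr1 val iE.
  (* The point [i = 0] lies in box 0, which is not the last one since [1 < N]. *)
  have i0 : (0 < i)%N.
    rewrite lt0n; apply/eqP => i0; move: boxi.
    by rewrite /fr /fl i0 mul0r floor0 subr0 mulr0 truncn0; lia.
  exists (i : nat); first by rewrite i0 ltn_ord.
  have : N.-1%:R <= N%:R * fr i by rewrite boxi truncn_le mulr_ge0 ?ler0n.
  have := dist_int_le (i%:R * xi) (fl i + 1).
  have -> : `|i%:R * xi - (fl i + 1)%:~R| = 1 - fr i.
    have := fr_lt1 i; rewrite /fr intrD => ?.
    by rewrite ler0_norm; lra.
  rewrite -(ler_pM2l N0) => di; have -> : N.-1%:R = N%:R - 1 :> R.
    by rewrite -subn1 natrB //; lia.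
  lra.
case/injectivePn => i [j ij boxE].
wlog ltij : i j ij boxE / (i < j)%N => [wl|].
  have [/wl|ji|ijE] := ltngtP i j; first exact.
    by apply: (wl j i); rewrite 1?eq_sym.
  by move: ij; rewrite (val_inj ijE) eqxx.
have {}boxE : Num.truncn (N%:R * fr i) = Num.truncn (N%:R * fr j).
  exact: (congr1 val boxE).
exists (j - i)%N; first by have := ltn_ord j; lia.
have := dist_int_le ((j - i)%:R * xi) (fl j - fl i).
rewrite natrB; last exact: ltnW.
have -> : (j%:R - i%:R) * xi - (fl j - fl i)%:~R = fr j - fr i.
  by rewrite /fr intrB; ring.
rewrite -(ler_pM2l N0); move/le_trans; apply.
rewrite -[X in X * _](gtr0_norm N0) -normrM mulrBr ltW // ltr_norml.
have Nfr_ge0 k : 0 <= N%:R * fr k by rewrite mulr_ge0 ?ler0n.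
have := truncn_itv (Nfr_ge0 i); have := truncn_itv (Nfr_ge0 j).
by rewrite boxE -natr1 => /andP[? ?] /andP[? ?]; lra.
Qed.

Lemma dist_int_gt0 {R : realType} (xi : R) (n : nat) :
  irrational xi -> (0 < n)%N -> 0 < dist_int (n%:R * xi).
Proof.
move=> irr n0; rewrite lt_def dist_int_ge0 andbT; apply/eqP => d0; apply: irr.
have [k] := dist_int_attained (n%:R * xi); rewrite d0 => /esym/eqP.
rewrite normr_eq0 subr_eq0 => /eqP nE.
apply/rationalP; exists k, n; rewrite -nE mulrAC mulfV ?mul1r //.
by rewrite pnatr_eq0; lia.
Qed.

Lemma dist_int_small {R : realType} (xi e : R) : 0 < e ->
  exists2 n : nat, (0 < n)%N & dist_int (n%:R * xi) < e.
Proof.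
(* One successor already makes [N] exceed [e^-1]; the second secures [1 < N] for [dirichlet]. *)
move=> e0; pose N := (Num.truncn e^-1).+2.
have [//|n /andP[n0 _] dn] := dirichlet xi N.
exists n => //.
have Ne : 1 < N%:R * e.
  rewrite -ltr_pdivrMr // mul1r.
  have /andP[_ /lt_le_trans] : (Num.truncn e^-1)%:R <= e^-1 < (Num.truncn e^-1).+1%:R.
    by apply: truncn_itv; rewrite invr_ge0 ltW.
  by apply; rewrite ler_nat.
rewrite -(@ltr_pM2l _ N%:R) ?ltr0n //; exact: le_lt_trans dn Ne.
Qed.

(** * Pairs of lattice vectors and their determinants *)

Lemma det_remainders {R : realType} (xi : R) (b s : nat) (p q : int) :
  let u := b%:R * xi - p%:~R in let v := s%:R * xi - q%:~R in
  s%:R * u - b%:R * v = (b%:Z * q - s%:Z * p)%:~R.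
Proof. by move=> u v; rewrite /u /v intrB !intrM; ring. Qed.

Lemma consecutive_minima {R : realType} (xi : R) (b s : nat) (p q : int) :
    irrational xi -> (0 < b < s)%N ->
    dist_int (s%:R * xi) < dist_int (b%:R * xi) ->
    (forall x : nat, (0 < x < s)%N ->
       dist_int (b%:R * xi) <= dist_int (x%:R * xi)) ->
    dist_int (b%:R * xi) = `|b%:R * xi - p%:~R| ->
    dist_int (s%:R * xi) = `|s%:R * xi - q%:~R| ->
  (b%:R * xi - p%:~R) * (s%:R * xi - q%:~R) < 0 /\
  s%:R * dist_int (b%:R * xi) + b%:R * dist_int (s%:R * xi) = 1.
Proof.
move=> irr /andP[b0 bs] dsb bmin db ds.
have s0 : (0 < s)%N by lia.
have := dist_int_gt0 xi b irr b0; have := dist_int_gt0 xi s irr s0.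
have detE := det_remainders xi b s p q; rewrite /= in detE.
(* Dirichlet gives [s eta <= 1], hence [s eta + b eta' < 2]; being a nonzero
   integer in absolute value, this sum is 1. *)
have sdb : s%:R * dist_int (b%:R * xi) <= 1.
  have [|n n0s sdn] := dirichlet xi s; first lia.
  by apply: le_trans sdn; rewrite ler_wpM2l ?ler0n ?bmin.
have sub_ge : dist_int (b%:R * xi) <=
    `|(s%:R * xi - q%:~R) - (b%:R * xi - p%:~R)|.
  apply: le_trans (bmin (s - b)%N _) _; first lia.
  apply: le_trans (dist_int_le _ (q - p)) _.
  by rewrite natrB ?(ltnW bs) // intrB; rewrite le_eqVlt; apply/orP; left; apply/eqP; congr (`|_|); ring.
have bR : 0 < b%:R :> R by rewrite ltr0n.
have bsR : b%:R < s%:R :> R by rewrite ltr_nat.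
move: dsb sdb sub_ge detE; rewrite db ds.
move: (b%:R * xi - p%:~R) (s%:R * xi - q%:~R) => u v vu su uv detE v0 u0.
(* With equal signs and [0 < |v| < |u|], [|v - u| = |u| - |v| < |u|]: then [s - b] would beat [b],
   against [sub_ge]. *)
have uv0 : u * v < 0.
  rewrite ltNge; apply/negP => uv_ge0.
  move: uv; rewrite leNgt => /negP; apply.
  case: (ltrgt0P u) u0 vu su => [u0|u0|->] u0' vu su; last by rewrite ltxx in u0'.
    have v_gt0 : 0 <= v by rewrite pmulr_rge0 in uv_ge0.
    rewrite (ger0_norm v_gt0) in v0 vu; rewrite ltr0_norm; lra.
  have v_lt0 : v <= 0 by rewrite nmulr_rge0 in uv_ge0.
  rewrite (ler0_norm v_lt0) in v0 vu; rewrite gtr0_norm; lra.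
split=> //; set D := b%:Z * q - s%:Z * p in detE.
(* Opposite signs leave no cancellation in the determinant [s u - b v]. *)
have normE : s%:R * `|u| + b%:R * `|v| = `|D%:~R|.
  rewrite -detE; case: (ltrgt0P u) u0 uv0 => [u0|u0|->] u0' uv0; last by rewrite ltxx in u0'.
    have v_lt0 : v < 0 by rewrite pmulr_rlt0 in uv0.
    by rewrite (ltr0_norm v_lt0) gtr0_norm; nra.
  have v_gt0 : 0 < v by rewrite nmulr_rlt0 in uv0.
  by rewrite (gtr0_norm v_gt0) ltr0_norm; nra.
have D_lt2 : `|D%:~R| < 2%:~R :> R.
  by rewrite -normE; nra.
have D_gt0 : 0 < `|D%:~R| :> R by rewrite -normE; nra.
rewrite normE; move: D_lt2 D_gt0; rewrite -intr_norm ltr_int ltr0z => ? ?.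
by have -> : `|D| = 1 by lia.
Qed.

(** Cramer's rule: the combination [q (b x) - p (s x)] is an integer and equals the determinant,
    here 1 or -1, times [x]. *)
Lemma int_of_unimodular {R : realType} (x : R) (b s : nat) (p q m n : int) :
  b%:R * x = m%:~R -> s%:R * x = n%:~R ->
  `|(b%:Z * q - s%:Z * p)%:~R| = 1 :> R -> x \is a Num.int.
Proof.
move=> bx sx det1.
have : (b%:Z * q - s%:Z * p)%:~R * x \is a Num.int.
  have -> : (b%:Z * q - s%:Z * p)%:~R * x = (q * m - p * n)%:~R.
    by rewrite !intrB !intrM -bx -sx; ring.
  exact: intr_int.
case: (ltrP (0 : R) (b%:Z * q - s%:Z * p)%:~R) (det1) => [D0|D0].
  by rewrite gtr0_norm // => ->; rewrite mul1r.
by rewrite ler0_norm // => /eqP; rewrite eqr_oppLR => /eqP ->; rewrite mulN1r rpredN.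
Qed.

Lemma dominated_pair_eq {R : realType} (alpha : R) (a a' b s : nat)
    (p q : int) (eta eta' : R) :
    (0 < a <= b)%N -> (b < a' <= s)%N ->
    let w := a%:R * alpha - p%:~R in let w' := a'%:R * alpha - q%:~R in
    0 < `|w'| < `|w| -> `|w| <= eta -> `|w'| <= eta' ->
    s%:R * eta + b%:R * eta' = 1 ->
  [/\ a = b, a' = s, `|w| = eta, `|w'| = eta' & w * w' < 0 /\
      `|(a%:Z * q - a'%:Z * p)%:~R| = 1 :> R].
Proof.
move=> /andP[a0 ab] /andP[ba' a's] w w' /andP[w'0 w'w] weta w'eta sum1.
have detE : a'%:R * w - a%:R * w' = _ := det_remainders alpha a a' p q.
move: (a%:Z * q - a'%:Z * p) detE => D detE.
have aR : 0 < a%:R :> R by rewrite ltr0n.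
have abR : a%:R <= b%:R :> R by rewrite ler_nat.
have ba'R : b%:R < a'%:R :> R by rewrite ltr_nat.
have a'sR : a'%:R <= s%:R :> R by rewrite ler_nat.
have le1 : a'%:R * `|w| <= s%:R * eta by rewrite ler_pM //; lra.
have le2 : a%:R * `|w'| <= b%:R * eta' by rewrite ler_pM //; lra.
have tri : `|D%:~R| <= a'%:R * `|w| + a%:R * `|w'|.
  rewrite -detE; apply: le_trans (ler_normB _ _) _.
  by rewrite !normrM !normr_nat.
(* The integer [D] is nonzero because [a |w'| < a' |w|]. *)
have D_ge1 : 1 <= `|D%:~R| :> R.
  apply: norm_intr_ge1; first exact: intr_int.
  rewrite -normr_gt0 -detE; apply: lt_le_trans (lerB_dist _ _).
  by rewrite !normrM !normr_nat; nra.
(* The chain from 1 to 1 is tight, so both products attain their bounds; their factors being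
   positive and bounded one by one, each factor does too. *)
have aw : a%:R * `|w'| = b%:R * eta' by lra.
have a'w : a'%:R * `|w| = s%:R * eta by lra.
have w'E : `|w'| = eta' by nra.
have wE : `|w| = eta by nra.
have abE : a%:R = b%:R :> R by nra.
have a'sE : a'%:R = s%:R :> R by nra.
have D1 : `|D%:~R| = 1 :> R by lra.
split=> //.
- by apply/eqP; rewrite -(eqr_nat R) abE.
- by apply/eqP; rewrite -(eqr_nat R) a'sE.
split=> //.
(* Equality in the triangle inequality, squared: the cross terms show that [- w w'] equals
   [|w| |w'|], hence is positive. *)
have sqE : (a'%:R * w - a%:R * w') ^+ 2 = (a'%:R * `|w| + a%:R * `|w'|) ^+ 2.
  by rewrite detE -[LHS](real_normK (num_real _)) D1 a'w aw sum1.
rewrite sqrrB sqrrD !exprMn !(real_normK (num_real _)) in sqE.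
have ww'_gt0 : 0 < (a'%:R * `|w|) * (a%:R * `|w'|).
  by rewrite !mulr_gt0 //; lra.
have : (a'%:R * a%:R) * (w * w') < 0 by lra.
by rewrite pmulr_rlt0 // mulr_gt0 //; lra.
Qed.

(** * Comparison of the two irrationality measures *)

Lemma irr_measure_le_nat {R : realType} (xi : R) (n x : nat) :
  (0 < x <= n)%N -> irr_measure xi n%:R <= dist_int (x%:R * xi).
Proof. by move=> xn; apply: (@irr_measure_le _ xi n%:R x); rewrite ler1n ler_nat. Qed.

Lemma irr_measure_attained_nat {R : realType} (xi : R) (n : nat) : (0 < n)%N ->
  exists2 x : nat, (0 < x <= n)%N & irr_measure xi n%:R = dist_int (x%:R * xi).
Proof.
move=> n0; have [|[x|x]] := @irr_measure_attained _ xi n%:R; first by rewrite ler1n.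
  by rewrite ler1n ler_nat => xn ?; exists x.
by rewrite NegzE mulrNz => /andP[x1 _]; have := ler0n R x.+1; rewrite -pmulrn in x1; lra.
Qed.

(** Serves both to locate a drop of the measure of [alpha] and to find the best denominator of
    [beta] that follows a given one. *)
Lemma first_below {R : realType} (xi e : R) : 0 < e ->
  exists n : nat, [/\ (0 < n)%N, dist_int (n%:R * xi) < e
    & forall x : nat, (0 < x < n)%N -> e <= dist_int (x%:R * xi)].
Proof.
move=> e0.
have ex : exists n : nat, (0 < n)%N && (dist_int (n%:R * xi) < e).
  by have [n n0 dn] := dist_int_small xi e e0; exists n; rewrite n0.
case: (ex_minnP ex) => n /andP[n0 dn] nmin; exists n; split=> // x /andP[x0 xn].
rewrite leNgt; apply/negP => dx; have := nmin x; rewrite x0 dx => /(_ isT); lia.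
Qed.

Lemma irr_measure_exceeds {R : realType} (alpha beta : R) :
    irrational alpha -> irrational beta ->
    alpha + beta \isn't a Num.int -> alpha - beta \isn't a Num.int ->
  forall T : R, exists2 t : R, T < t & irr_measure beta t < irr_measure alpha t.
Proof.
move=> irra irrb /negP sum_nint /negP diff_nint T; apply: contrapT => no_t.
pose N := (Num.truncn `|T|).+1.
have TN : T < N%:R.
  by apply: le_lt_trans (ler_norm T) _; have /andP[] := truncn_itv (normr_ge0 T).
have dom n : (N <= n)%N -> irr_measure alpha n%:R <= irr_measure beta n%:R.
  move=> Nn; rewrite leNgt; apply/negP => lt; apply: no_t; exists n%:R => //.
  by apply: lt_le_trans TN _; rewrite ler_nat.
have psi_gt0 (xi : R) n : irrational xi -> (0 < n)%N -> 0 < irr_measure xi n%:R.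
  move=> irr n0; have [x /andP[x0 _] ->] := irr_measure_attained_nat xi n n0.
  exact: dist_int_gt0.
have N0 : (0 < N)%N by [].
(* Taking [Q] at least [x] puts the drop [q] of [alpha] after [x], where the measure of [beta] is
   below its value at [N]; this forces [N < b]. *)
have [x x0 dx] := dist_int_small beta _ (psi_gt0 beta N irrb N0).
pose Q := maxn x N; have Q0 : (0 < Q)%N by lia.
have [q [q0 dq qmin]] := first_below alpha _ (psi_gt0 alpha Q irra Q0).
have Qq : (Q < q)%N.
  rewrite ltnNge; apply/negP => qQ; move: dq; rewrite ltNge => /negP; apply.
  by apply: irr_measure_le_nat; rewrite q0.
(* Minimising up to [q - 1] gives [b < q <= s] for the next best denominator [s], so that [alpha]
   drops between [b] and [s]. *)
have [|b /andP[b0 bq] dbE] := irr_measure_attained_nat beta q.-1; first lia.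
have Nb : (N < b)%N.
  rewrite ltnNge; apply/negP => bN; move: dx; rewrite ltNge => /negP; apply.
  apply: le_trans (irr_measure_le_nat beta N b _) _; first by rewrite b0.
  by rewrite -dbE; apply: irr_measure_le_nat; lia.
have [s [s0 ds smin]] := first_below beta _ (dist_int_gt0 beta b irrb b0).
have qs : (q <= s)%N.
  rewrite leqNgt; apply/negP => sq; move: ds; rewrite ltNge => /negP; apply.
  by rewrite -dbE; apply: irr_measure_le_nat; lia.
have [a /andP[a0 ab] daE] := irr_measure_attained_nat alpha b b0.
have [a' /andP[a'0 a's] da'E] := irr_measure_attained_nat alpha s s0.
have da'q : dist_int (a'%:R * alpha) < irr_measure alpha Q%:R.
  by apply: le_lt_trans dq; rewrite -da'E; apply: irr_measure_le_nat; lia.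
have da'a : dist_int (a'%:R * alpha) < dist_int (a%:R * alpha).
  by apply: lt_le_trans da'q _; apply: qmin; lia.
(* No denominator below [q] gets under the measure of [alpha] at [Q], whereas [a'] does. *)
have ba' : (b < a')%N.
  rewrite ltnNge; apply/negP => a'b; move: da'q; rewrite ltNge => /negP; apply.
  by apply: qmin; lia.
have dab : dist_int (a%:R * alpha) <= dist_int (b%:R * beta).
  rewrite -daE; apply: le_trans (dom b (ltnW Nb)) _.
  by apply: irr_measure_le_nat; rewrite b0 /=.
have da's : dist_int (a'%:R * alpha) <= dist_int (s%:R * beta).
  rewrite -da'E; apply: le_trans (dom s _) _; first lia.
  by apply: irr_measure_le_nat; rewrite s0 /=.
have da'0 := dist_int_gt0 alpha a' irra a'0.
have [p pE] := dist_int_attained (a%:R * alpha).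
have [p' p'E] := dist_int_attained (a'%:R * alpha).
have [r rE] := dist_int_attained (b%:R * beta).
have [r' r'E] := dist_int_attained (s%:R * beta).
have bs : (0 < b < s)%N by lia.
have [uv0 sum1] := consecutive_minima beta b s r r' irrb bs ds smin rE r'E.
have := dominated_pair_eq alpha a a' b s p p' (dist_int (b%:R * beta))
  (dist_int (s%:R * beta)).
rewrite /= -pE -p'E a0 ab ba' a's da'0 da'a.
case=> // abE a'sE wE w'E [ww'0 det1]; subst a a'.
move: wE w'E; rewrite pE rE p'E r'E => wE w'E.
(* Remainders agree up to sign. Mixed signs contradict [uv0] and [ww'0]; equal signs make
   [alpha - beta] an integer, and opposite signs [alpha + beta]. *)
have /orP[/eqP w|/eqP w] : (b%:R * alpha - p%:~R == b%:R * beta - r%:~R)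
    || (b%:R * alpha - p%:~R == - (b%:R * beta - r%:~R)) by rewrite -eqr_norm2 wE.
all: have /orP[/eqP w'|/eqP w'] : (s%:R * alpha - p'%:~R == s%:R * beta - r'%:~R)
    || (s%:R * alpha - p'%:~R == - (s%:R * beta - r'%:~R)) by rewrite -eqr_norm2 w'E.
- apply: diff_nint.
  apply: (int_of_unimodular _ b s p p' (p - r) (p' - r')) det1;
  rewrite intrB mulrBr; lra.
- by move: ww'0; rewrite w w' mulrN oppr_lt0 ltNge ltW.
- by move: ww'0; rewrite w w' mulNr oppr_lt0 ltNge ltW.
- apply: sum_nint.
  apply: (int_of_unimodular _ b s p p' (p + r) (p' + r')) det1;
  rewrite intrD mulrDr; lra.
Qed.

Theorem theorem1 (R : realType) (alpha beta : R)
    (irr_alpha : irrational alpha) (irr_beta : irrational beta)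
    (neq_ab : alpha <> beta)
    (sum_nint : alpha + beta \isn't a Num.int)
    (diff_nint : alpha - beta \isn't a Num.int) :
  forall T : R, 0 < T ->
    exists t1 t2 : R,
      [/\ T < t1, T < t2,
          irr_measure beta t1 < irr_measure alpha t1
        & irr_measure alpha t2 < irr_measure beta t2].
Proof.
move=> T _.
have [t1 Tt1 lt1] :=
  irr_measure_exceeds alpha beta irr_alpha irr_beta sum_nint diff_nint T.
(* The hypotheses are symmetric in [alpha] and [beta]. *)
have [t2 Tt2 lt2] : exists2 t, T < t & irr_measure alpha t < irr_measure beta t.
  apply: irr_measure_exceeds => //; first by rewrite addrC.
  by rewrite -opprB rpredN.
by exists t1, t2.
Qed.
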